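(* Let $p(n)$ denote the number of positive integers $m \le n$ such that $B(m) = B(m^2)$, where $B(x)$ is the number of ones in the binary expansion of $x$. Then $p(n) \gg n^{0.025}$; that is, there is a constant $c>0$ such that $p(n) \ge c\, n^{0.025}$ for all positive integers $n$.
   Context: For a positive integer $x$, $B(x)$ denotes the sum of the binary digits of $x$ (its Hamming weight). A positive integer $m$ is called a (2,1,2)-number if $B(m)=B(m^2)$. *)

(* Defs.v *)
From mathcomp Require Import all_boot.

Set Implicit Arguments.
Unset Strict Implicit.
Unset Printing Implicit Defensive.

(* The binary digits of x > 0 are those of weight 2 ^ i with
   0 <= i <= trunc_log 2 x; for x = 0 the sum below is 0. *)
Definition B (x : nat) : nat :=
  \sum_(0 <= i < (trunc_log 2 x).+1) (x %/ 2 ^ i) %% 2.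

Definition is_212 (m : nat) : bool := (0 < m) && (B m == B (m ^ 2)).

Definition p (n : nat) : nat := count is_212 (iota 1 n).

(* Main.v *)
(* For 1 <= z <= 2 ^ h the number m = 2 ^ d - 2 ^ c + 2 ^ b - z, with c - b = k,
   d - c = g and b = k + g + h + 1, has a square whose binary expansion splits
   into disjoint blocks, so that B m and B (m ^ 2) are explicit. Both contain
   - B (z - 1), and B (m ^ 2) the additional term B (z ^ 2); choosing g in terms
   of B (z ^ 2) makes them equal. With h = f this yields 2 ^ f solutions below
   2 ^ (9 f + O(1)), distinct because m = - z modulo 2 ^ f. Hence p n is at
   least of order n ^ (1/9), of which only the exponent 1/40 is used. *)

Require Import Defs.
From mathcomp Require Import all_boot all_order all_algebra.
From mathcomp Require Import reals exp.
From mathcomp Require Import zify ring.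

Set Implicit Arguments.
Unset Strict Implicit.
Unset Printing Implicit Defensive.

Import Order.TTheory GRing.Theory Num.Theory.
Local Open Scope ring_scope.

Section BinaryDigitSum.
Local Open Scope nat_scope.

(** Digits beyond the leading one vanish, so the length fixed in [B] may be replaced by any
    sufficient one, as inductions on digits require. *)
Lemma B_digits (N x : nat) : x < 2 ^ N -> B x = \sum_(i < N) (x %/ 2 ^ i) %% 2.
Proof.
have high (a b : nat) : x < 2 ^ a ->
    \sum_(0 <= i < a + b) (x %/ 2 ^ i) %% 2 = \sum_(0 <= i < a) (x %/ 2 ^ i) %% 2.
  move=> xa; rewrite (big_cat_nat (n := a)) ?leq_addr //=.
  rewrite [X in _ + X]big_nat [X in _ + X]big1 ?addn0 //.
  by move=> i /andP[ai _]; rewrite divn_small // (leq_trans xa) // leq_exp2l.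
have xt : x < 2 ^ (trunc_log 2 x).+1 by apply: trunc_log_ltn.
move=> xN; rewrite -(big_mkord xpredT (fun i => (x %/ 2 ^ i) %% 2)).
by rewrite -(high N (trunc_log 2 x).+1 xN) addnC (high _ N xt).
Qed.

Lemma B0 : B 0 = 0.
Proof. by rewrite (@B_digits 0) // big_ord0. Qed.

Lemma B_bit (b : bool) (x : nat) : B (x * 2 + b) = B x + b.
Proof.
have xN : x < 2 ^ x by apply: ltn_expl.
rewrite (@B_digits x.+1) ?expnS; last by case: b => /=; lia.
rewrite (B_digits xN) big_ord_recl addnC expn0 divn1 modnMDl; congr (_ + _).
  apply: eq_bigr => i _; rewrite /bump /= expnS divnMA divnMDl //.
  by case: b; rewrite addn0.
by case: b.
Qed.

Lemma B_cat (e a b : nat) : b < 2 ^ e -> B (a * 2 ^ e + b) = B a + B b.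
Proof.
elim: e b => [|e IH] b lt_b.
  by case: b lt_b => // _; rewrite B0 muln1 !addn0.
rewrite {1}(divn_eq b 2) {3}(divn_eq b 2) modn2.
rewrite expnS in lt_b; rewrite expnS.
have -> : a * (2 * 2 ^ e) + (b %/ 2 * 2 + odd b) =
  (a * 2 ^ e + b %/ 2) * 2 + odd b by ring.
by rewrite !B_bit IH ?addnA // ltn_divLR //; lia.
Qed.

(** Subtracting [b] from [2 ^ e - 1] flips each of its [e] low digits. *)
Lemma B_compl (e b : nat) : b < 2 ^ e -> B (2 ^ e - b.+1) + B b = e.
Proof.
elim: e b => [|e IH] b lt_b.
  by case: b lt_b => // _; rewrite subnn B0.
have lt_h : b %/ 2 < 2 ^ e by rewrite ltn_divLR // mulnC -expnS.
have -> : 2 ^ e.+1 - b.+1 = (2 ^ e - (b %/ 2).+1) * 2 + ~~ odd b.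
  rewrite expnS in lt_b; rewrite expnS; have := divn_eq b 2; rewrite modn2.
  by case: (odd b) => /=; lia.
rewrite B_bit {3}(divn_eq b 2) modn2 B_bit -[in RHS](IH _ lt_h).
by case: (odd b) => /=; lia.
Qed.

Lemma B_ones (e : nat) : B (2 ^ e - 1) = e.
Proof. by have := @B_compl e 0; rewrite B0 addn0 expn_gt0 => ->. Qed.

Lemma B_le (e b : nat) : b < 2 ^ e -> B b <= e.
Proof. by move=> /B_compl <-; apply: leq_addl. Qed.

Lemma B_gt0 (x : nat) : 0 < x -> 0 < B x.
Proof.
elim/ltn_ind: x => x IH x0; have := divn_eq x 2; rewrite modn2 => ->.
rewrite B_bit; have [xo|xe] := boolP (odd x); first by lia.
by rewrite addn_gt0 IH //; lia.
Qed.

(** The product consists of [z - 1] followed by its [e]-digit complement [2 ^ e - z]. *)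
Lemma B_mul_ones (e z : nat) : 0 < z <= 2 ^ e -> B ((2 ^ e - 1) * z) = e.
Proof.
case: z => // z /= ze.
have -> : (2 ^ e - 1) * z.+1 = z * 2 ^ e + (2 ^ e - z.+1).
  by rewrite mulnBl mul1n mulnS addnC mulnC addnBA.
rewrite B_cat; first by rewrite addnC B_compl.
by rewrite ltn_subrL (leq_ltn_trans _ ze).
Qed.

End BinaryDigitSum.

Section Family.
Local Open Scope nat_scope.

Definition member (k g h z : nat) : nat :=
  (2 ^ g - 1) * 2 ^ (k + (k + g + h).+1) + (2 ^ (k + g + h).+1 - z).

Lemma B_member (k g h z : nat) : 0 < z <= 2 ^ h ->
  B (member k g h z) + B z.-1 = g + (k + g + h).+1.
Proof.
case: z => // z /= zh.
have hb : 2 ^ h <= 2 ^ (k + g + h).+1 by rewrite leq_exp2l //; lia.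
rewrite /member B_cat; first by rewrite B_ones -addnA B_compl //; lia.
rewrite (@leq_trans (2 ^ (k + g + h).+1)) ?leq_exp2l //; lia.
Qed.

(** In terms of the exponents [b], [c], [d], the blocks from the top are [2^(2d) - 2^(c+d+1)],
    [2^(b+d+1)], [2^(2c) - 2^(b+c+1)], [2^(2b) - z 2^(d+1)], [z (2^(c+1) - 2^(b+1))] and [z^2]. The
    value of [b] gives [2b = d + 1 + h], so the fourth is a shift of [2^h - z]. *)
Lemma member_sqr (k g h z : nat) : z <= 2 ^ h ->
  member k.+1 g.+1 h z ^ 2 =
  (((((2 ^ g - 1) * 2 ^ k.+1 + 1) * 2 ^ g.+1 + (2 ^ k - 1)) * 2 ^ (k.+2 + h)
    + (2 ^ h - z)) * 2 ^ (k.+1 + g.+1) + (2 ^ k.+1 - 1) * z)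
  * 2 ^ (k.+1 + g.+1 + h).+2 + z ^ 2.
Proof.
move=> zh; rewrite /member !(addnS, addSn, expnS, expnD).
have := expn_gt0 2 k; have := expn_gt0 2 g; move: zh => /=.
(* Writing the powers as [z + u], [G.+1] and [K.+1] lets the truncated subtractions be eliminated,
   which leaves a polynomial identity. *)
move: (2 ^ h) (2 ^ g) (2 ^ k) => H [//|G] [//|K] /subnKC <- _ _.
move: (H - z) => u.
have -> : z + u - z = u by lia.
have -> : 2 * G.+1 - 1 = 2 * G + 1 by lia.
have -> : 2 * K.+1 - 1 = 2 * K + 1 by lia.
rewrite !subn1 /= expn0.
have -> : 2 * (2 * K.+1 * (2 * G.+1) * (z + u)) - z =
    (8 * K * G + 8 * K + 8 * G + 7) * z + (8 * K * G + 8 * K + 8 * G + 8) * u.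
  rewrite (_ : 2 * (2 * K.+1 * (2 * G.+1) * (z + u)) =
    (8 * K * G + 8 * K + 8 * G + 7) * z + (8 * K * G + 8 * K + 8 * G + 8) * u + z) ?addnK //.
  by ring.
ring.
Qed.

(** The blocks have weights [g], [1], [k], [B (2 ^ h - z)], [k.+1] and [B (z ^ 2)]; the fourth and
    [B z.-1] add up to [h] by complementation. *)
Lemma B_member_sqr (k g h z : nat) :
    0 < z <= 2 ^ h -> z <= 2 ^ k -> k <= g.+1 -> z <= 2 ^ g ->
    z ^ 2 < 2 ^ (k.+1 + g.+1 + h).+2 ->
  B (member k.+1 g.+1 h z ^ 2) + B z.-1 = g + k + h + k.+2 + B (z ^ 2).
Proof.
move=> /andP[z0 zh] zk kg zg z2; rewrite member_sqr // B_cat //.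
have lt_k : 2 ^ k - 1 < 2 ^ g.+1.
  by rewrite (leq_trans _ (leq_pexp2l _ kg)) //; have := expn_gt0 2 k; lia.
have lt_h : 2 ^ h - z < 2 ^ (k.+2 + h).
  by rewrite (@leq_trans (2 ^ h)) ?leq_exp2l ?leq_addl //; have := expn_gt0 2 h; lia.
have lt_z : (2 ^ k.+1 - 1) * z < 2 ^ (k.+1 + g.+1).
  rewrite expnD [2 ^ g.+1]expnS; have := expn_gt0 2 k.+1; have := expn_gt0 2 g.
  by move: (2 ^ k.+1) (2 ^ g) zg => a b /=; nia.
rewrite B_cat // B_mul_ones; last by rewrite z0 expnS; lia.
rewrite B_cat // B_cat // B_ones B_cat; last by rewrite expnS; have := expn_gt0 2 k; lia.
rewrite B_ones (B_ones 1).
have := @B_compl h z.-1; rewrite prednK // => /(_ zh).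
by lia.
Qed.

Lemma member_gt0 (k g h z : nat) : z <= 2 ^ h -> 0 < member k g h z.
Proof.
move=> zh; rewrite /member addn_gt0 subn_gt0 (leq_ltn_trans zh) ?orbT //.
by rewrite ltn_exp2l //; lia.
Qed.

Lemma member_le (k g h z : nat) : member k g h z <= 2 ^ (k.*2 + g.*2 + h).+1.
Proof.
have -> : (k.*2 + g.*2 + h).+1 = g + (k + (k + g + h).+1) by lia.
rewrite expnD /member mulnBl mul1n.
have : 2 ^ (k + g + h).+1 <= 2 ^ (k + (k + g + h).+1) by rewrite leq_exp2l ?leq_addl.
have := expn_gt0 2 g; move: (2 ^ g) (2 ^ (k + _)) (2 ^ _) => a b c /=; nia.
Qed.

Lemma dvdn_memberD (k g h z : nat) : z <= 2 ^ h -> 2 ^ h %| member k g h z + z.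
Proof.
move=> zh; rewrite /member -addnA subnK.
  by rewrite dvdn_add ?dvdn_mull ?dvdn_exp2l //; lia.
by rewrite (leq_trans zh) ?leq_exp2l //; lia.
Qed.

(* Equating B_member and B_member_sqr forces g = k - 2 + B (z ^ 2). *)
Definition solution (f z : nat) : nat := member f.+3 (f + B (z ^ 2)).+1 f z.

Lemma B_sqr_le (f z : nat) : z <= 2 ^ f -> B (z ^ 2) <= f.*2.+1.
Proof.
move=> zf; apply: B_le; rewrite (@leq_ltn_trans ((2 ^ f) ^ 2)) ?leq_sqr //.
by rewrite -expnM ltn_exp2l // muln2.
Qed.

Lemma is_212_solution (f z : nat) : 0 < z <= 2 ^ f -> is_212 (solution f z).
Proof.
move=> /andP[z0 zf]; rewrite /is_212 member_gt0 //=.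
(* This yields the condition [k <= g.+1] of [B_member_sqr], here [f.+2 <= (f + B (z ^ 2)).+1]. *)
have Bz0 : 0 < B (z ^ 2) by rewrite B_gt0 // expn_gt0 z0.
have zf' e : f <= e -> z <= 2 ^ e by move=> fe; rewrite (leq_trans zf) ?leq_exp2l.
have E1 := @B_member f.+3 (f + B (z ^ 2)).+1 f z.
have E2 := @B_member_sqr f.+2 (f + B (z ^ 2)) f z.
rewrite z0 zf in E1 E2; have {}E1 := E1 isT.
apply/eqP; rewrite /solution; apply: (@addIn (B z.-1)); rewrite E1 E2 ?zf' //; try lia.
rewrite (@leq_ltn_trans ((2 ^ f) ^ 2)) ?leq_sqr // -expnM ltn_exp2l //; lia.
Qed.

Lemma solution_le (f z : nat) : z <= 2 ^ f -> solution f z <= 2 ^ (9 * f + 11).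
Proof.
(* The exponent is at most [2 (f + 3) + 2 (3 f + 2) + f + 1 = 9 f + 11]. *)
move=> zf; apply: leq_trans (member_le _ _ _ _) _; rewrite leq_exp2l //.
by have := B_sqr_le zf; lia.
Qed.

Lemma solution_inj (f : nat) : {in iota 1 (2 ^ f) &, injective (solution f)}.
Proof.
move=> y z; rewrite !mem_iota => /andP[y0 yf] /andP[z0 zf] E.
have yF : y <= 2 ^ f by lia.
have zF : z <= 2 ^ f by lia.
have := dvdn_memberD f.+3 (f + B (y ^ 2)).+1 yF.
have := dvdn_memberD f.+3 (f + B (z ^ 2)).+1 zF.
rewrite -!/(solution f _) E /dvdn => /eqP Ez /eqP Ey.
have /eqP : y = z %[mod 2 ^ f] by apply/eqP; rewrite -(eqn_modDl (solution f z)) Ey Ez.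
(* Residues are compared after a shift by one, since [z = 2 ^ f] is allowed and [z.-1 < 2 ^ f]. *)
have : y.-1 + 1 = y by lia.
have : z.-1 + 1 = z by lia.
by move=> <- <-; rewrite eqn_modDr !modn_small; [move/eqP -> | lia | lia].
Qed.

Lemma leq_p (m n : nat) : m <= n -> p m <= p n.
Proof. by move=> mn; rewrite /p -(subnKC mn) iotaD count_cat leq_addr. Qed.

Lemma p_exp_ge (f : nat) : 2 ^ f <= p (2 ^ (9 * f + 11)).
Proof.
rewrite -[2 ^ f](size_iota 1) -(size_map (solution f)) /p -size_filter.
apply: uniq_leq_size; first by rewrite (map_inj_in_uniq (@solution_inj f)) iota_uniq.
move=> _ /mapP[z + ->]; rewrite mem_iota => /andP[z0 zf].
have zF : z <= 2 ^ f by lia.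
rewrite mem_filter is_212_solution ?z0 //= mem_iota member_gt0 //=.
by rewrite add1n ltnS solution_le.
Qed.

Lemma p_gt0 (n : nat) : 0 < n -> 0 < p n.
Proof.
move=> n0; apply: leq_trans (leq_p n0).
by rewrite /p /= /is_212 exp1n eqxx.
Qed.

(** Integer form of the bound with [25 / 1000 = 1 / 40] and constant [1 / 2]. *)
Lemma leq_p_pow (n : nat) : 0 < n -> n <= (2 * p n) ^ 40.
Proof.
move=> n0; have nt : n < 2 ^ (trunc_log 2 n).+1 by apply: trunc_log_ltn.
have tn : 2 ^ trunc_log 2 n <= n by apply: trunc_logP.
have [f fp tf] : exists2 f, 2 ^ f <= p n & trunc_log 2 n < 40 * f.+1.
  have [tlt|tge] := ltnP (trunc_log 2 n) 11.
    by exists 0; [exact: p_gt0 | lia].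
  (* The largest [f] with [9 f + 11 <= trunc_log 2 n]; then
     [trunc_log 2 n <= 9 f + 19 < 40 (f + 1)]. *)
  exists ((trunc_log 2 n - 11) %/ 9); last by lia.
  apply: leq_trans (p_exp_ge _) _; apply: leq_p; apply: leq_trans tn.
  by rewrite leq_exp2l //; lia.
apply: ltnW; apply: leq_trans nt _.
apply: (@leq_trans ((2 * 2 ^ f) ^ 40)); last by rewrite leq_exp2r // leq_mul2l fp.
by rewrite -expnS -expnM leq_exp2l // mulnC.
Qed.

End Family.

Theorem theorem1 (R : realType) :
  exists c : R, 0 < c /\
    forall n : nat, (0 < n)%N -> c * (n%:R `^ (25 / 1000)) <= (p n)%:R.
Proof.
exists (2^-1); split=> [|n n0]; first by rewrite invr_gt0.
rewrite ler_pdivrMl // -natrM.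
have -> : (2 * p n)%:R = ((2 * p n) ^ 40)%:R `^ (25 / 1000) :> R.
  rewrite natrX -powR_mulrn ?ler0n // -powRrM.
  by rewrite (_ : 40%:R * (25 / 1000) = 1 :> R) ?powRr1 ?ler0n //; field.
by apply: ge0_ler_powR; rewrite ?nnegrE ?ler0n ?divr_ge0 ?ler0n // ler_nat leq_p_pow.
Qed.
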